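(* Let $\beta\in\mathbb{D}$ be fixed and let $T$ be the weighted shift operator on the Hardy space $H^2(\mathbb{D})$, $T\left(\sum_{n\ge0}a_nz^n\right)=\sum_{n\ge0}a_n\beta_{n+1}z^{n+1}$, with weights $\beta_n=\beta^{n-1}$ (so $\beta_{n+1}=\beta^{n}$ for $n\ge0$, with $\beta^0=1$). Then the Berezin range $\mathrm{Ber}(T)$ is a disc centred at the origin, and is therefore convex.
   Context: $\mathbb{D}$ is the open unit disc in $\mathbb{C}$. $H^2(\mathbb{D})$ is the Hilbert space of holomorphic functions $f(z)=\sum_{n\ge0}a_nz^n$ on $\mathbb{D}$ with $\sum|a_n|^2<\infty$, with inner product $\langle f,g\rangle=\sum_{n\ge0}a_n\overline{b_n}$ for $g(z)=\sum_{n\ge 0} b_nz^n$. Its reproducing kernel is $k_\lambda(z)=\frac1{1-\bar\lambda z}$, and the normalized kernel is $\hat k_\lambda=k_\lambda/\|k_\lambda\|$. For a bounded operator $T$ on $H^2(\mathbb{D})$, the Berezin range is $\mathrm{Ber}(T)=\{\langle T\hat k_\lambda,\hat k_\lambda\rangle:\lambda\in\mathbb{D}\}$. The disc may be open or closed. *)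

(* Defs.v *)
From Stdlib Require Import Reals Lra Lia.
From Stdlib Require Import FunctionalExtensionality ProofIrrelevance ClassicalEpsilon.
From Coquelicot Require Import Coquelicot.

Open Scope R_scope.

Record unit_disc : Type := mk_disc { disc_val :> C; disc_lt1 : Cmod disc_val < 1 }.

Definition l2 (a : nat -> C) : Prop := ex_series (fun n => Cmod (a n) ^ 2).

Definition expansion (a : nat -> C) (f : unit_disc -> C) : Prop :=
  forall z : unit_disc, is_pseries (K := C_AbsRing) (V := C_NormedModule) a (disc_val z) (f z).

Lemma pow_n_Cpow (z : C) n : pow_n (K := C_Ring) z n = (z ^ n)%C.
Proof. induction n as [|n IH]; [reflexivity|]. simpl. now rewrite IH. Qed.

Lemma is_pseries_C (a : nat -> C) (z l : C) :
  is_pseries (K := C_AbsRing) (V := C_NormedModule) a z l <->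
  is_series (K := C_AbsRing) (V := C_NormedModule) (fun n => (z ^ n * a n)%C) l.
Proof.
split; apply is_series_ext; intros n.
- change (pow_n (K := C_Ring) z n * a n = z ^ n * a n)%C. now rewrite (pow_n_Cpow z n).
- change (z ^ n * a n = pow_n (K := C_Ring) z n * a n)%C. now rewrite (pow_n_Cpow z n).
Qed.

Lemma sum_n_fst (u : nat -> C) n : fst (sum_n u n) = sum_n (fun k => fst (u k)) n.
Proof.
induction n as [|n IH]; [now rewrite !sum_O|]. rewrite !sum_Sn, <- IH. reflexivity.
Qed.

Lemma sum_n_snd (u : nat -> C) n : snd (sum_n u n) = sum_n (fun k => snd (u k)) n.
Proof.
induction n as [|n IH]; [now rewrite !sum_O|]. rewrite !sum_Sn, <- IH. reflexivity.
Qed.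

Lemma is_series_C (u : nat -> C) (l : C) :
  is_series (K := C_AbsRing) (V := C_NormedModule) u l <->
  is_series (fun n => fst (u n)) (fst l) /\ is_series (fun n => snd (u n)) (snd l).
Proof.
split.
- intros H; split; intros P [e He]; destruct (H (ball l e)) as [N HN];
    try (now exists e); exists N; intros n Hn; apply He; specialize (HN n Hn).
  + rewrite <- sum_n_fst. exact (proj1 HN).
  + rewrite <- sum_n_snd. exact (proj2 HN).
- intros [H1 H2] P [e He].
  destruct (H1 (ball (fst l) e)) as [N1 HN1]; [now exists e|].
  destruct (H2 (ball (snd l) e)) as [N2 HN2]; [now exists e|].
  exists (N1 + N2)%nat; intros n Hn; apply He.
  split.
  + change (ball (fst l) e (fst (sum_n u n))). rewrite sum_n_fst. apply HN1; lia.
  + change (ball (snd l) e (snd (sum_n u n))). rewrite sum_n_snd. apply HN2; lia.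
Qed.

Lemma is_series_C_unique (u : nat -> C) (l l' : C) :
  is_series (K := C_AbsRing) (V := C_NormedModule) u l ->
  is_series (K := C_AbsRing) (V := C_NormedModule) u l' -> l = l'.
Proof.
rewrite !is_series_C. intros [H1 H2] [H1' H2'].
apply is_series_unique in H1, H2, H1', H2'.
destruct l, l'; simpl in *; congruence.
Qed.

Lemma ex_series_C_abs (u : nat -> C) (b : nat -> R) :
  (forall n, Cmod (u n) <= b n) -> ex_series b ->
  exists l : C, is_series (K := C_AbsRing) (V := C_NormedModule) u l.
Proof.
intros H1 H2.
exact (ex_series_le (K := C_AbsRing) (V := C_CompleteNormedModule) u b H1 H2).
Qed.

Lemma amgm (x y : R) : x * y <= x ^ 2 + y ^ 2.
Proof. nra. Qed.

Lemma l2_geom (q : C) : Cmod q < 1 -> l2 (fun n => (q ^ n)%C).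
Proof.
intros Hq. apply ex_series_ext with (fun n => (Cmod q ^ 2) ^ n).
- intros n. rewrite Cmod_pow, <- !pow_mult. f_equal; lia.
- apply ex_series_geom. pose proof (Cmod_ge_0 q). rewrite Rabs_pos_eq; nra.
Qed.

Lemma l2_expansion_ex (a : nat -> C) (z : unit_disc) : l2 a ->
  exists l : C, is_pseries (K := C_AbsRing) (V := C_NormedModule) a (disc_val z) l.
Proof.
intros Ha. apply ex_series_C_abs with (fun n => Cmod (z ^ n) ^ 2 + Cmod (a n) ^ 2).
- intros n. change (Cmod (pow_n (K := C_Ring) (disc_val z) n * a n) <=
    Cmod (z ^ n) ^ 2 + Cmod (a n) ^ 2).
  rewrite pow_n_Cpow, Cmod_mult. apply amgm.
- exact (ex_series_plus (K := R_AbsRing) (V := R_NormedModule) _ _ (l2_geom z (disc_lt1 z)) Ha).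
Qed.

Lemma PSeries_zero_coef (c : nat -> R) :
  (forall x, Rabs x < 1 -> is_series (fun n => c n * x ^ n) 0) -> forall n, c n = 0.
Proof.
intros H n.
assert (Hr : Rbar_lt 0 (CV_radius c)).
{ apply Rbar_lt_le_trans with (/ 2); [simpl; lra|].
  apply Rbar_not_lt_le. intros Hlt.
  apply (CV_disk_outside c (/ 2)).
  - rewrite Rabs_pos_eq; [exact Hlt|lra].
  - apply (ex_series_lim_0 (fun n => c n * (/ 2) ^ n)).
    exists 0. apply H. rewrite Rabs_pos_eq; lra. }
change 0 with ((fun _ : nat => 0) n).
assert (Hz : forall x, is_series (fun n : nat => 0 * x ^ n) 0).
{ intros x.
  pose proof (is_series_scal_l (K := R_AbsRing) (V := R_NormedModule) 0 _ _
    (is_series_geom 0 ltac:(rewrite Rabs_R0; lra))) as H0.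
  change (scal 0 (/ (1 - 0))) with (0 * (/ (1 - 0))) in H0. rewrite Rmult_0_l in H0.
  apply is_series_ext with (2 := H0). intros k.
  change (scal 0 (0 ^ k)) with (0 * 0 ^ k). now rewrite !Rmult_0_l. }
apply PSeries_ext_recip; [exact Hr| |].
- apply Rbar_lt_le_trans with (/ 2); [simpl; lra|].
  apply Rbar_not_lt_le. intros Hlt.
  apply (CV_disk_outside (fun _ => 0) (/ 2)).
  + rewrite Rabs_pos_eq; [exact Hlt|lra].
  + apply (ex_series_lim_0 (fun n => 0 * (/ 2) ^ n)). exists 0. apply Hz.
- exists (mkposreal 1 Rlt_0_1). intros x Hx.
  assert (Hx' : Rabs x < 1).
  { replace x with (x - 0) by ring. exact Hx. }
  unfold PSeries. rewrite (is_series_unique _ 0 (H x Hx')), (is_series_unique _ 0 (Hz x)).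
  reflexivity.
Qed.

Lemma expansion_unique (f : unit_disc -> C) (a b : nat -> C) :
  expansion a f -> expansion b f -> forall n, a n = b n.
Proof.
intros Ha Hb n.
assert (Hmain : forall x, Rabs x < 1 ->
  is_series (fun n => (fst (a n) - fst (b n)) * x ^ n) 0 /\
  is_series (fun n => (snd (a n) - snd (b n)) * x ^ n) 0).
{ intros x Hx.
  assert (Hd : Cmod (RtoC x) < 1) by now rewrite Cmod_R.
  pose proof (is_series_minus _ _ _ _ (proj1 (is_pseries_C _ _ _) (Ha (mk_disc _ Hd)))
    (proj1 (is_pseries_C _ _ _) (Hb (mk_disc _ Hd)))) as H.
  rewrite (plus_opp_r (G := C_AbelianGroup)) in H.
  apply is_series_C in H. destruct H as [H1 H2].
  change (fst (@zero C_AbelianGroup)) with 0 in H1.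
  change (snd (@zero C_AbelianGroup)) with 0 in H2.
  split.
  - eapply is_series_ext; [|exact H1]. intros k.
    change (fst (RtoC x ^ k * a k - RtoC x ^ k * b k)%C = (fst (a k) - fst (b k)) * x ^ k).
    rewrite <- RtoC_pow.
    destruct (a k), (b k). unfold RtoC, plus, opp; simpl. ring.
  - eapply is_series_ext; [|exact H2]. intros k.
    change (snd (RtoC x ^ k * a k - RtoC x ^ k * b k)%C = (snd (a k) - snd (b k)) * x ^ k).
    rewrite <- RtoC_pow.
    destruct (a k), (b k). unfold RtoC, plus, opp; simpl. ring. }
pose proof (PSeries_zero_coef _ (fun x Hx => proj1 (Hmain x Hx)) n) as E1.
pose proof (PSeries_zero_coef _ (fun x Hx => proj2 (Hmain x Hx)) n) as E2.
simpl in E1, E2. destruct (a n), (b n); simpl in *; f_equal; lra.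
Qed.

(** Being holomorphic on the disc is the existence of a power series expansion there;
    the coefficients are unique by [expansion_unique]. *)
Record H2 : Type := mk_H2 {
  H2_fun :> unit_disc -> C;
  H2_spec : exists a : nat -> C, expansion a H2_fun /\ l2 a }.

Definition coef (f : H2) : nat -> C :=
  proj1_sig (constructive_indefinite_description _ (H2_spec f)).

Lemma coef_expansion (f : H2) : expansion (coef f) f.
Proof. unfold coef. now destruct constructive_indefinite_description as [a [? ?]]. Qed.

Lemma coef_l2 (f : H2) : l2 (coef f).
Proof. unfold coef. now destruct constructive_indefinite_description as [a [? ?]]. Qed.

Lemma coef_eq (f : H2) (a : nat -> C) : expansion a f -> forall n, coef f n = a n.
Proof. intros Ha. exact (expansion_unique f _ _ (coef_expansion f) Ha). Qed.

Lemma H2_eq (f g : H2) : (forall z, f z = g z) -> f = g.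
Proof.
destruct f as [f Hf], g as [g Hg]; simpl; intros H.
assert (E : f = g) by now apply functional_extensionality.
subst g. f_equal. apply proof_irrelevance.
Qed.

Lemma H2_coef_eq (f g : H2) : (forall n, coef f n = coef g n) -> f = g.
Proof.
intros H. apply H2_eq. intros z.
apply (is_series_C_unique _ _ _ (coef_expansion f z)).
apply is_series_ext with (2 := coef_expansion g z). intros n. now rewrite H.
Qed.

Lemma H2_of_coef_spec (a : nat -> C) : l2 a ->
  expansion a (fun z => iota (T := C_CompleteNormedModule)
                 (is_pseries (K := C_AbsRing) (V := C_NormedModule) a (disc_val z))).
Proof.
intros Ha z. apply (iota_correct (V := C_CompleteNormedModule)).
destruct (l2_expansion_ex a z Ha) as [l Hl].
exists l. split; [exact Hl|]. intros l' Hl'. exact (is_series_C_unique _ _ _ Hl Hl').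
Qed.

(** [H2_of_coef a _] is the function z |-> sum_n a_n z^n. *)
Definition H2_of_coef (a : nat -> C) (Ha : l2 a) : H2 :=
  mk_H2 _ (ex_intro _ a (conj (H2_of_coef_spec a Ha) Ha)).

Lemma coef_H2_of_coef (a : nat -> C) (Ha : l2 a) n : coef (H2_of_coef a Ha) n = a n.
Proof. exact (coef_eq (H2_of_coef a Ha) _ (H2_of_coef_spec a Ha) n). Qed.

Lemma l2_plus (a b : nat -> C) : l2 a -> l2 b -> l2 (fun n => (a n + b n)%C).
Proof.
intros Ha Hb.
apply (ex_series_le (K := R_AbsRing) (V := R_CompleteNormedModule)) with
  (fun n => 2 * Cmod (a n) ^ 2 + 2 * Cmod (b n) ^ 2).
- intros n. change (Rabs (Cmod (a n + b n) ^ 2) <=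
                      2 * Cmod (a n) ^ 2 + 2 * Cmod (b n) ^ 2).
  pose proof (Cmod_triangle (a n) (b n)). pose proof (Cmod_ge_0 (a n + b n)).
  rewrite Rabs_pos_eq; [|apply pow2_ge_0].
  apply Rle_trans with ((Cmod (a n) + Cmod (b n)) ^ 2); [apply pow_incr; lra|].
  pose proof (pow2_ge_0 (Cmod (a n) - Cmod (b n))). lra.
- exact (ex_series_plus (K := R_AbsRing) (V := R_NormedModule) _ _
    (ex_series_scal_l (K := R_AbsRing) (V := R_NormedModule) 2 _ Ha)
    (ex_series_scal_l (K := R_AbsRing) (V := R_NormedModule) 2 _ Hb)).
Qed.

Lemma l2_scal (c : C) (a : nat -> C) : l2 a -> l2 (fun n => (c * a n)%C).
Proof.
intros Ha. apply ex_series_ext with (fun n => scal (Cmod c ^ 2) (Cmod (a n) ^ 2)).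
- intros n. rewrite Cmod_mult. unfold scal; simpl; unfold mult; simpl. ring.
- exact (ex_series_scal _ _ Ha).
Qed.

Lemma H2_plus_expansion (f g : H2) :
  expansion (fun n => (coef f n + coef g n)%C) (fun z => (f z + g z)%C).
Proof.
intros z.
eapply is_series_ext;
  [|exact (is_series_plus _ _ _ _ (coef_expansion f z) (coef_expansion g z))].
intros n. symmetry. exact (scal_distr_l (V := C_ModuleSpace) _ _ _).
Qed.

Lemma H2_scal_expansion (c : C) (f : H2) :
  expansion (fun n => (c * coef f n)%C) (fun z => (c * f z)%C).
Proof.
intros z.
eapply is_series_ext; [|exact (is_series_scal c _ _ (coef_expansion f z))].
intros n. change (c * (pow_n (K := C_Ring) (disc_val z) n * coef f n) =
                  pow_n (K := C_Ring) (disc_val z) n * (c * coef f n))%C. ring.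
Qed.

Definition H2_plus (f g : H2) : H2 := mk_H2 (fun z => (f z + g z)%C)
  (ex_intro _ _ (conj (H2_plus_expansion f g) (l2_plus _ _ (coef_l2 f) (coef_l2 g)))).

Definition H2_scal (c : C) (f : H2) : H2 := mk_H2 (fun z => (c * f z)%C)
  (ex_intro _ _ (conj (H2_scal_expansion c f) (l2_scal c _ (coef_l2 f)))).

Lemma coef_plus (f g : H2) n : coef (H2_plus f g) n = (coef f n + coef g n)%C.
Proof. exact (coef_eq (H2_plus f g) _ (H2_plus_expansion f g) n). Qed.

Lemma coef_scal (c : C) (f : H2) n : coef (H2_scal c f) n = (c * coef f n)%C.
Proof. exact (coef_eq (H2_scal c f) _ (H2_scal_expansion c f) n). Qed.

Lemma is_series_C_geom (q : C) : Cmod q < 1 ->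
  is_series (K := C_AbsRing) (V := C_NormedModule) (fun n => (q ^ n)%C) (/ (1 - q))%C.
Proof.
intros Hq.
assert (Hne : (1 - q)%C <> 0).
{ intros E. assert (q = 1)%C as ->.
  { replace q with (1 - (1 - q))%C by ring. rewrite E. ring. }
  rewrite Cmod_1 in Hq. lra. }
destruct (ex_series_C_abs (fun n => (q ^ n)%C) (fun n => Cmod q ^ n)) as [l Hl].
- intros n. rewrite Cmod_pow. lra.
- apply ex_series_geom. rewrite Rabs_pos_eq; [exact Hq|apply Cmod_ge_0].
- assert (Hl' := is_series_scal (V := C_NormedModule) q _ _ Hl).
  assert (Hl'' : is_series (K := C_AbsRing) (V := C_NormedModule)
                  (fun n => (q ^ n)%C) (1 + q * l)%C).
  { apply is_series_decr_1.
    change (is_series (K := C_AbsRing) (V := C_NormedModule)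
              (fun n => (q * q ^ n)%C) (1 + q * l - 1)%C).
    replace (1 + q * l - 1)%C with (q * l)%C by ring. exact Hl'. }
  assert (E : l = (1 + q * l)%C) by exact (is_series_C_unique _ _ _ Hl Hl'').
  replace (/ (1 - q))%C with l; [exact Hl|].
  assert (E2 : ((1 - q) * l)%C = 1%C).
  { replace ((1 - q) * l)%C with (l - q * l)%C by ring. rewrite E at 1. ring. }
  replace l with ((1 - q) * l * / (1 - q))%C by now field.
  rewrite E2. ring.
Qed.

Lemma Cmod_conj_lt1 (lam : unit_disc) : Cmod (Cconj lam) < 1.
Proof. rewrite Cmod_conj. apply disc_lt1. Qed.

Lemma kernel_expansion (lam : unit_disc) :
  expansion (fun n => (Cconj lam ^ n)%C) (fun z => (/ (1 - Cconj lam * z))%C).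
Proof.
intros z. apply is_pseries_C. eapply is_series_ext; [|apply is_series_C_geom].
- intros n. simpl. rewrite Cpow_mult_l. apply Cmult_comm.
- rewrite Cmod_mult.
  pose proof (Cmod_conj_lt1 lam). pose proof (disc_lt1 z).
  pose proof (Cmod_ge_0 (Cconj lam)). pose proof (Cmod_ge_0 z). nra.
Qed.

Definition kernel (lam : unit_disc) : H2 := mk_H2 (fun z => (/ (1 - Cconj lam * z))%C)
  (ex_intro _ _ (conj (kernel_expansion lam) (l2_geom _ (Cmod_conj_lt1 lam)))).

Lemma coef_kernel (lam : unit_disc) n : coef (kernel lam) n = (Cconj lam ^ n)%C.
Proof. exact (coef_eq (kernel lam) _ (kernel_expansion lam) n). Qed.

(** [iota] selects the unique limit of the complex series; see [inner_correct]. *)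
Definition inner (f g : H2) : C :=
  iota (T := C_CompleteNormedModule)
    (is_series (K := C_AbsRing) (V := C_NormedModule)
       (fun n => (coef f n * Cconj (coef g n))%C)).

Definition H2_norm (f : H2) : R := sqrt (Re (inner f f)).

Lemma inner_correct (f g : H2) :
  is_series (K := C_AbsRing) (V := C_NormedModule)
    (fun n => (coef f n * Cconj (coef g n))%C) (inner f g).
Proof.
apply (iota_correct (V := C_CompleteNormedModule)
  (is_series (K := C_AbsRing) (V := C_NormedModule)
     (fun n => (coef f n * Cconj (coef g n))%C))).
destruct (ex_series_C_abs (fun n => (coef f n * Cconj (coef g n))%C)
            (fun n => Cmod (coef f n) ^ 2 + Cmod (coef g n) ^ 2)) as [l Hl].
- intros n. rewrite Cmod_mult, Cmod_conj. apply amgm.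
- exact (ex_series_plus (K := R_AbsRing) (V := R_NormedModule) _ _ (coef_l2 f) (coef_l2 g)).
- exists l. split; [exact Hl|]. intros l' Hl'. exact (is_series_C_unique _ _ _ Hl Hl').
Qed.

Lemma H2_norm_eq (f : H2) : H2_norm f = sqrt (Series (fun n => Cmod (coef f n) ^ 2)).
Proof.
unfold H2_norm. f_equal. symmetry. apply is_series_unique.
eapply is_series_ext; [|exact (proj1 (proj1 (is_series_C _ _) (inner_correct f f)))].
intros n. change (Re (coef f n * Cconj (coef f n))%C = Cmod (coef f n) ^ 2).
rewrite <- Cmod2_conj. reflexivity.
Qed.

Lemma Series_l2_ge0 (f : H2) : 0 <= Series (fun n => Cmod (coef f n) ^ 2).
Proof.
replace 0 with (Series (fun n => 0 * Cmod (coef f n) ^ 2)).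
- apply Series_le; [|exact (coef_l2 f)].
  intros n. pose proof (pow2_ge_0 (Cmod (coef f n))). lra.
- rewrite Series_scal_l. ring.
Qed.

Lemma H2_norm_ge0 (f : H2) : 0 <= H2_norm f.
Proof. apply sqrt_pos. Qed.

Lemma H2_norm_sq (f : H2) : H2_norm f ^ 2 = Series (fun n => Cmod (coef f n) ^ 2).
Proof. rewrite H2_norm_eq. apply pow2_sqrt, Series_l2_ge0. Qed.

Lemma H2_norm_le_of_coef (f g : H2) (M : R) : 0 <= M ->
  Series (fun n => Cmod (coef f n) ^ 2) <=
  M ^ 2 * Series (fun n => Cmod (coef g n) ^ 2) ->
  H2_norm f <= M * H2_norm g.
Proof.
rewrite <- !H2_norm_sq. intros HM H.
pose proof (H2_norm_ge0 f). pose proof (H2_norm_ge0 g).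
apply Rsqr_incr_0; unfold Rsqr; nra.
Qed.

Lemma H2_norm_scal (c : C) (f : H2) : H2_norm (H2_scal c f) <= Cmod c * H2_norm f.
Proof.
apply H2_norm_le_of_coef; [apply Cmod_ge_0|].
rewrite <- Series_scal_l. apply Req_le, Series_ext. intros n.
rewrite coef_scal, Cmod_mult. ring.
Qed.

Lemma H2_norm_eq0_coef (f : H2) : H2_norm f = 0 -> forall n, coef f n = 0.
Proof.
intros H n. apply Cmod_eq_0.
pose proof (H2_norm_sq f) as E. rewrite H in E.
set (u := fun n => Cmod (coef f n) ^ 2) in *.
assert (Hu : forall k, 0 <= u k) by (intros; apply pow2_ge_0).
assert (Hle : u n <= Series u).
{ rewrite (Series_incr_n u (S n)); [|lia|exact (coef_l2 f)].
  assert (0 <= Series (fun k => u (S n + k)%nat)).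
  { replace 0 with (Series (fun k => 0 * u (S n + k)%nat)) by (rewrite Series_scal_l; ring).
    apply Series_le; [intros k; pose proof (Hu (S n + k)%nat); lra|].
    apply (proj1 (ex_series_incr_n (K := R_AbsRing) (V := R_NormedModule) u (S n))). exact (coef_l2 f). }
  assert (u n <= sum_f_R0 u (pred (S n))).
  { simpl. destruct n as [|n]; simpl; [lra|].
    assert (0 <= sum_f_R0 u n) by (apply cond_pos_sum; exact Hu). lra. }
  lra. }
specialize (Hu n). pose proof (Cmod_ge_0 (coef f n)).
assert (E2 : Cmod (coef f n) ^ 2 = 0) by (fold (u n); lra).
nra.
Qed.

Lemma H2_norm_triangle (f g : H2) : H2_norm (H2_plus f g) <= H2_norm f + H2_norm g.
Proof.
pose proof (H2_norm_ge0 f) as Nf. pose proof (H2_norm_ge0 g) as Ng.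
destruct (Req_dec (H2_norm f) 0) as [Zf|Zf].
{ replace (H2_plus f g) with g; [lra|].
  apply H2_coef_eq. intros n. rewrite coef_plus, (H2_norm_eq0_coef f Zf n). ring. }
destruct (Req_dec (H2_norm g) 0) as [Zg|Zg].
{ replace (H2_plus f g) with f; [lra|].
  apply H2_coef_eq. intros n. rewrite coef_plus, (H2_norm_eq0_coef g Zg n). ring. }
set (t := H2_norm g / H2_norm f).
assert (Ht : 0 < t) by (apply Rdiv_lt_0_compat; lra).
assert (E : H2_norm (H2_plus f g) ^ 2 <=
            (1 + t) * H2_norm f ^ 2 + (1 + / t) * H2_norm g ^ 2).
{ rewrite !H2_norm_sq, <- !Series_scal_l, <- Series_plus;
    try (apply (ex_series_scal_l (K := R_AbsRing) (V := R_NormedModule)), coef_l2).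
  apply Series_le.
  - intros n. split; [apply pow2_ge_0|]. rewrite coef_plus.
    set (x := coef f n). set (y := coef g n).
    pose proof (Cmod_triangle x y). pose proof (Cmod_ge_0 (x + y)).
    apply Rle_trans with ((Cmod x + Cmod y) ^ 2); [apply pow_incr; lra|].
    assert (0 <= / t * (t * Cmod x - Cmod y) ^ 2).
    { apply Rmult_le_pos; [now left; apply Rinv_0_lt_compat|apply pow2_ge_0]. }
    replace (/ t * (t * Cmod x - Cmod y) ^ 2) with
      (t * Cmod x ^ 2 - 2 * Cmod x * Cmod y + / t * Cmod y ^ 2) in * by (field; lra).
    lra.
  - apply (ex_series_plus (K := R_AbsRing) (V := R_NormedModule));
      apply (ex_series_scal_l (K := R_AbsRing) (V := R_NormedModule)), coef_l2. }
replace ((1 + t) * H2_norm f ^ 2 + (1 + / t) * H2_norm g ^ 2) with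
  ((H2_norm f + H2_norm g) ^ 2) in E by (unfold t; field; lra).
apply Rsqr_incr_0; [|apply H2_norm_ge0|lra]. unfold Rsqr; lra.
Qed.

Definition H2_opp (f : H2) : H2 := H2_scal (Copp (RtoC 1)) f.

Lemma H2_zero_spec : exists a : nat -> C, expansion a (fun _ => RtoC 0) /\ l2 a.
Proof.
assert (H01 : Cmod 0 < 1) by (rewrite Cmod_0; lra).
exists (fun n => (0 * 0 ^ n)%C). split; [|exact (l2_scal 0 _ (l2_geom 0 H01))].
intros z. apply is_pseries_C.
pose proof (is_series_scal (K := C_AbsRing) (V := C_NormedModule) (RtoC 0) _ _
              (is_series_C_geom 0 H01)) as H.
change (scal (RtoC 0) (/ (1 - 0))%C) with (0 * / (1 - 0))%C in H.
rewrite Cmult_0_l in H.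
apply is_series_ext with (2 := H). intros n.
change (0 * 0 ^ n = disc_val z ^ n * (0 * 0 ^ n))%C. ring.
Qed.

Definition H2_zero : H2 := mk_H2 (fun _ => RtoC 0) H2_zero_spec.

Definition H2_AbelianMonoid_mixin : AbelianMonoid.mixin_of H2.
Proof.
apply (AbelianMonoid.Mixin H2 H2_plus H2_zero);
  intros; apply H2_eq; intros; simpl; ring.
Defined.
Canonical H2_AbelianMonoid := AbelianMonoid.Pack H2 H2_AbelianMonoid_mixin H2.

Definition H2_AbelianGroup_mixin : AbelianGroup.mixin_of H2_AbelianMonoid.
Proof.
apply (AbelianGroup.Mixin H2_AbelianMonoid H2_opp).
intros f; apply H2_eq; intros z; simpl; ring.
Defined.
Canonical H2_AbelianGroup :=
  AbelianGroup.Pack H2 (AbelianGroup.Class H2 _ H2_AbelianGroup_mixin) H2.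

Definition H2_ModuleSpace_mixin : ModuleSpace.mixin_of C_Ring H2_AbelianGroup.
Proof.
apply (ModuleSpace.Mixin C_Ring H2_AbelianGroup H2_scal);
  intros; apply H2_eq; intros; simpl; unfold plus, mult, one; simpl; ring.
Defined.
Canonical H2_ModuleSpace :=
  ModuleSpace.Pack C_Ring H2 (ModuleSpace.Class C_Ring H2 _ H2_ModuleSpace_mixin) H2.

Definition H2_ball (f : H2) (eps : R) (g : H2) : Prop :=
  H2_norm (H2_plus g (H2_opp f)) < eps.

Lemma H2_norm_0 : H2_norm H2_zero = 0.
Proof.
apply Rle_antisym; [|apply H2_norm_ge0].
replace H2_zero with (H2_scal 0 H2_zero) by (apply H2_eq; intros z; simpl; ring).
eapply Rle_trans; [apply H2_norm_scal|]. rewrite Cmod_0. lra.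
Qed.

Definition H2_UniformSpace_mixin : UniformSpace.mixin_of H2.
Proof.
apply (UniformSpace.Mixin H2 H2_zero H2_ball); unfold H2_ball.
- intros f e. replace (H2_plus f (H2_opp f)) with H2_zero.
  + rewrite H2_norm_0. apply cond_pos.
  + apply H2_eq; intros z; simpl; ring.
- intros f g e H. eapply Rle_lt_trans; [|exact H].
  replace (H2_plus f (H2_opp g)) with (H2_scal (Copp (RtoC 1)) (H2_plus g (H2_opp f)))
    by (apply H2_eq; intros z; simpl; ring).
  eapply Rle_trans; [apply H2_norm_scal|].
  rewrite Cmod_opp, Cmod_1. lra.
- intros f g h e1 e2 H1 H2.
  replace (H2_plus h (H2_opp f)) with
    (H2_plus (H2_plus g (H2_opp f)) (H2_plus h (H2_opp g)))
    by (apply H2_eq; intros z; simpl; ring).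
  eapply Rle_lt_trans; [apply H2_norm_triangle|]. lra.
Defined.
Canonical H2_UniformSpace := UniformSpace.Pack H2 H2_UniformSpace_mixin H2.

Canonical H2_NormedModuleAux := NormedModuleAux.Pack C_AbsRing H2
  (NormedModuleAux.Class C_AbsRing H2
     (ModuleSpace.class C_Ring H2_ModuleSpace) H2_UniformSpace_mixin) H2.

Definition H2_NormedModule_mixin : NormedModule.mixin_of C_AbsRing H2_NormedModuleAux.
Proof.
apply (NormedModule.Mixin C_AbsRing H2_NormedModuleAux H2_norm 1).
- exact H2_norm_triangle.
- exact H2_norm_scal.
- intros f g eps H. exact H.
- intros f g eps H. rewrite Rmult_1_l. exact H.
- intros f H. apply H2_coef_eq. intros n.
  rewrite (H2_norm_eq0_coef f H n). symmetry. exact (H2_norm_eq0_coef H2_zero H2_norm_0 n).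
Defined.
Canonical H2_NormedModule := NormedModule.Pack C_AbsRing H2
  (NormedModule.Class C_AbsRing H2 _ H2_NormedModule_mixin) H2.

(** [is_linear] is Coquelicot's notion of bounded linear map. *)
Record bounded_operator : Type := mk_bounded_operator {
  bop :> H2 -> H2;
  bop_linear : is_linear (K := C_AbsRing) (U := H2_NormedModule) (V := H2_NormedModule) bop }.

Definition normalized_kernel (lam : unit_disc) : H2 :=
  H2_scal (RtoC (/ H2_norm (kernel lam))) (kernel lam).

Definition Ber (T : bounded_operator) (w : C) : Prop :=
  exists lam : unit_disc, w = inner (T (normalized_kernel lam)) (normalized_kernel lam).

(** Weights are indexed from 1: z^n is sent to w_(n+1) z^(n+1); [w 0] is not used. *)
Definition shift_coef (w a : nat -> C) (n : nat) : C :=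
  match n with O => 0 | S m => (a m * w (S m))%C end.

Definition bounded_weights (w : nat -> C) : Prop :=
  exists M : R, forall n, Cmod (w n) <= M.

Lemma shift_coef_le (w a : nat -> C) (M : R) : (forall n, Cmod (w n) <= M) ->
  forall n, 0 <= Cmod (shift_coef w a (S n)) ^ 2 <= M ^ 2 * Cmod (a n) ^ 2.
Proof.
intros HM n. split; [apply pow2_ge_0|]. simpl shift_coef. rewrite Cmod_mult.
pose proof (HM (S n)). pose proof (Cmod_ge_0 (w (S n))). pose proof (Cmod_ge_0 (a n)).
rewrite Rpow_mult_distr, Rmult_comm. apply Rmult_le_compat_r; [apply pow2_ge_0|].
apply pow_incr; lra.
Qed.

Lemma shift_coef_l2 (w a : nat -> C) : bounded_weights w -> l2 a -> l2 (shift_coef w a).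
Proof.
intros [M HM] Ha. apply ex_series_incr_1.
apply (ex_series_le (K := R_AbsRing) (V := R_CompleteNormedModule)) with
  (fun n => M ^ 2 * Cmod (a n) ^ 2).
- intros n. pose proof (shift_coef_le w a M HM n) as [H1 H2].
  unfold norm; simpl NormedModule.norm. unfold abs; simpl AbsRing.abs.
  rewrite Rabs_pos_eq; assumption.
- exact (ex_series_scal_l (K := R_AbsRing) (V := R_NormedModule) _ _ Ha).
Qed.

Definition weighted_shift_fun (w : nat -> C) (Hw : bounded_weights w) (f : H2) : H2 :=
  H2_of_coef (shift_coef w (coef f)) (shift_coef_l2 w (coef f) Hw (coef_l2 f)).

Lemma weighted_shift_linear (w : nat -> C) (Hw : bounded_weights w) :
  is_linear (K := C_AbsRing) (U := H2_NormedModule) (V := H2_NormedModule)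
    (weighted_shift_fun w Hw).
Proof.
split.
- intros f g. apply H2_coef_eq. intros n.
  change (plus ?x ?y) with (H2_plus x y).
  rewrite coef_plus. unfold weighted_shift_fun. rewrite !coef_H2_of_coef.
  destruct n as [|n]; simpl; [|change (plus f g) with (H2_plus f g); rewrite coef_plus]; ring.
- intros c f. apply H2_coef_eq. intros n.
  change (scal ?x ?y) with (H2_scal x y).
  rewrite coef_scal. unfold weighted_shift_fun. rewrite !coef_H2_of_coef.
  destruct n as [|n]; simpl; [|change (scal c f) with (H2_scal c f); rewrite coef_scal]; ring.
- destruct Hw as [M HM] eqn:EHw.
  assert (HM0 : 0 <= M) by (eapply Rle_trans; [apply Cmod_ge_0|exact (HM O)]).
  exists (M + 1). split; [lra|]. intros f.
  change (H2_norm (weighted_shift_fun w (ex_intro _ M HM) f) <= (M + 1) * H2_norm f).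
  apply Rle_trans with (M * H2_norm f); [|pose proof (H2_norm_ge0 f); lra].
  apply H2_norm_le_of_coef; [exact HM0|].
  rewrite Series_incr_1; [|apply coef_l2].
  unfold weighted_shift_fun. rewrite coef_H2_of_coef. simpl shift_coef.
  rewrite Cmod_0, <- Series_scal_l. rewrite pow_ne_zero by lia. rewrite Rplus_0_l.
  apply Series_le.
  + intros n. rewrite coef_H2_of_coef. now apply shift_coef_le.
  + exact (ex_series_scal_l (K := R_AbsRing) (V := R_NormedModule) _ _ (coef_l2 f)).
Qed.

Definition weighted_shift (w : nat -> C) (Hw : bounded_weights w) : bounded_operator :=
  mk_bounded_operator (weighted_shift_fun w Hw) (weighted_shift_linear w Hw).

Definition geom_weights (beta : C) (n : nat) : C := (beta ^ (n - 1))%C.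

Lemma geom_weights_bounded (beta : unit_disc) : bounded_weights (geom_weights beta).
Proof.
exists 1. intros n. unfold geom_weights. rewrite Cmod_pow.
rewrite <- (pow1 (n - 1)). apply pow_incr. split; [apply Cmod_ge_0|].
left. apply disc_lt1.
Qed.

Definition is_disc_centred (c : C) (S : C -> Prop) : Prop :=
  exists r : R, 0 < r /\
    ((forall w, S w <-> Cmod (w - c) < r) \/ (forall w, S w <-> Cmod (w - c) <= r)).

Definition convex_set (S : C -> Prop) : Prop :=
  forall (u v : C) (t : R), S u -> S v -> 0 <= t <= 1 ->
    S (RtoC (1 - t) * u + RtoC t * v)%C.

(* Main.v *)
Require Import Defs.
From Stdlib Require Import Reals Lra Lia.
From Coquelicot Require Import Coquelicot.

(** Summing a geometric series gives
    <T k^_lam, k^_lam> = lam (1 - |lam|^2) / (1 - beta |lam|^2),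
    whose modulus [ber_radius beta |lam|] depends only on |lam| and whose argument is free.
    The modulus is continuous on [0,1], vanishes at both ends and is positive in between,
    so it attains its maximum m at some point of (0,1), and the intermediate value theorem
    yields every modulus in [0,m]: the range is the closed disc of radius m. *)

Definition ber_symbol (beta lam : C) : C :=
  (lam * RtoC (1 - Cmod lam ^ 2) / (1 - beta * RtoC (Cmod lam ^ 2)))%C.

Definition ber_radius (beta : C) (r : R) : R :=
  r * (1 - r ^ 2) / Cmod (1 - beta * RtoC (r ^ 2)).

Lemma Cmod_1_minus_pos (q : C) : Cmod q < 1 -> 0 < Cmod (1 - q).
Proof.
intros Hq.
pose proof (Cmod_triangle (1 - q) q) as H.
replace (1 - q + q)%C with (RtoC 1) in H by ring.
rewrite Cmod_1 in H. lra.
Qed.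

(** Since [beta] lies in the open disc, the denominator stays nonzero even at [r = 1]; this lets the
    modulus be studied on the compact interval [0,1]. *)
Lemma Cmod_1_minus_scal_pos (beta : unit_disc) (r : R) : 0 <= r <= 1 ->
  0 < Cmod (1 - beta * RtoC (r ^ 2)).
Proof.
intros Hr. apply Cmod_1_minus_pos.
rewrite Cmod_mult, Cmod_R, Rabs_pos_eq by apply pow2_ge_0.
pose proof (disc_lt1 beta). pose proof (Cmod_ge_0 beta).
assert (0 <= r ^ 2 <= 1) by nra. nra.
Qed.

Lemma Cmod_ber_symbol (beta lam : unit_disc) :
  Cmod (ber_symbol beta lam) = ber_radius beta (Cmod lam).
Proof.
pose proof (disc_lt1 lam). pose proof (Cmod_ge_0 lam).
assert (Hp := Cmod_1_minus_scal_pos beta (Cmod lam) ltac:(lra)).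
unfold ber_symbol, ber_radius.
rewrite Cmod_div by (apply Cmod_gt_0; exact Hp).
rewrite Cmod_mult, Cmod_R, (Rabs_pos_eq (1 - _)) by nra. reflexivity.
Qed.

Lemma ber_radius_continuity_pt (beta : unit_disc) (r : R) : 0 <= r <= 1 ->
  continuity_pt (ber_radius beta) r.
Proof.
intros Hr. apply continuity_pt_filterlim.
assert (Hp := Cmod_1_minus_scal_pos beta r Hr).
(* The squared modulus of the denominator as a real polynomial, so that [auto_derive] can handle its
   square root. *)
pose (D := fun x : R => (1 - Re beta * x ^ 2) ^ 2 + (Im beta * x ^ 2) ^ 2).
assert (HD : forall x, Cmod (1 - beta * RtoC (x ^ 2)) = sqrt (D x)).
{ intros x. unfold Cmod, D, Re, Im. f_equal. simpl. ring. }
apply (continuous_ext (fun x => x * (1 - x ^ 2) / sqrt (D x))).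
{ intros x. unfold ber_radius. now rewrite HD. }
rewrite HD in Hp.
assert (HD0 : 0 < D r).
(* [sqrt] is 0 on nonpositive reals, so a positive root forces [D r] to be positive. *)
{ apply Rnot_le_lt. intros H. rewrite sqrt_neg_0 in Hp; lra. }
apply (ex_derive_continuous (K := R_AbsRing) (V := R_NormedModule)).
unfold D in *. auto_derive.
repeat split; [exact HD0|exact (Rgt_not_eq _ _ Hp)].
Qed.

Lemma ber_radius_range (beta : unit_disc) :
  exists m : R, 0 < m /\
    (forall r, 0 <= r < 1 -> ber_radius beta r <= m) /\
    (forall y, 0 <= y <= m -> exists r, 0 <= r < 1 /\ ber_radius beta r = y).
Proof.
destruct (continuity_ab_maj (ber_radius beta) 0 1) as [x [Hmax Hx]]; [lra| |].
{ intros r Hr. now apply ber_radius_continuity_pt. }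
assert (H0 : ber_radius beta 0 = 0) by (unfold ber_radius; lra).
assert (H1 : ber_radius beta 1 = 0) by (unfold ber_radius; lra).
assert (Hm : 0 < ber_radius beta x).
(* Any interior point would do to show the maximum positive; 1/2 is chosen. *)
{ apply Rlt_le_trans with (ber_radius beta (/ 2)); [|apply Hmax; lra].
  apply Rdiv_lt_0_compat; [lra|]. apply Cmod_1_minus_scal_pos; lra. }
assert (Hx01 : 0 < x < 1).
{ split; apply Rnot_le_lt; intros H.
  - replace x with 0 in Hm by lra. lra.
  - replace x with 1 in Hm by lra. lra. }
exists (ber_radius beta x). split; [exact Hm|]. split.
- intros r Hr. apply Hmax. lra.
- intros y Hy.
  (* Intermediate values are sought on [0,x], not [0,1]: then [r <= x < 1], so [r] is the modulus of
     a point of the open disc. *)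
  destruct (Ranalysis5.f_interv_is_interv (ber_radius beta) 0 x y) as [r [Hr E]].
  + lra.
  + now rewrite H0.
  + intros r Hr. apply ber_radius_continuity_pt. lra.
  + exists r. split; [lra|exact E].
Qed.

Lemma H2_norm_kernel_sq (lam : unit_disc) :
  H2_norm (kernel lam) ^ 2 = / (1 - Cmod lam ^ 2).
Proof.
rewrite H2_norm_sq. rewrite <- (Series_geom (Cmod lam ^ 2)).
- apply Series_ext. intros n.
  rewrite coef_kernel, Cmod_pow, Cmod_conj, <- !pow_mult. f_equal. lia.
- pose proof (disc_lt1 lam). pose proof (Cmod_ge_0 lam).
  rewrite Rabs_pos_eq; nra.
Qed.

Lemma Cconj_RtoC (x : R) : Cconj (RtoC x) = RtoC x.
Proof. unfold Cconj, RtoC; simpl. now rewrite Ropp_0. Qed.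

(** With c the normalizing factor, the term of index n+1 is c^2 lam (beta |lam|^2)^n, because
    conj(lam)^n lam^(n+1) = lam |lam|^(2n). This is a geometric series of ratio [q], and c^2 = 1 -
    |lam|^2. *)
Lemma inner_weighted_shift_normalized_kernel (beta lam : unit_disc) :
  inner (weighted_shift (geom_weights beta) (geom_weights_bounded beta)
           (normalized_kernel lam)) (normalized_kernel lam)
  = ber_symbol beta lam.
Proof.
pose proof (disc_lt1 lam) as Hl. pose proof (Cmod_ge_0 lam) as Hl0.
assert (Hp := Cmod_1_minus_scal_pos beta (Cmod lam) ltac:(lra)).
set (q := (beta * RtoC (Cmod lam ^ 2))%C) in *.
assert (Hq : Cmod q < 1).
{ unfold q. rewrite Cmod_mult, Cmod_R, Rabs_pos_eq by apply pow2_ge_0.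
  pose proof (disc_lt1 beta). pose proof (Cmod_ge_0 beta). nra. }
set (c := / H2_norm (kernel lam)).
assert (Hc : c * c = 1 - Cmod lam ^ 2).
{ unfold c. rewrite <- Rinv_mult.
  replace (H2_norm (kernel lam) * H2_norm (kernel lam))
    with (H2_norm (kernel lam) ^ 2) by ring.
  now rewrite H2_norm_kernel_sq, Rinv_inv. }
assert (Hcc : (RtoC c * RtoC c)%C = RtoC (1 - Cmod lam ^ 2)) by now rewrite <- RtoC_mult, Hc.
apply (is_series_C_unique _ _ _ (inner_correct _ _)).
(* The shifted function has zero constant coefficient, so the term of index 0 vanishes and the
   geometric series starts at index 1. *)
apply is_series_decr_1.
match goal with |- is_series _ ?l =>
  replace l with (RtoC (1 - Cmod lam ^ 2) * lam * / (1 - q))%C end.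
- eapply is_series_ext; [|exact (is_series_scal (K := C_AbsRing) (V := C_NormedModule)
    (RtoC (1 - Cmod lam ^ 2) * disc_val lam)%C _ _ (is_series_C_geom q Hq))].
  intros n.
  change (RtoC (1 - Cmod lam ^ 2) * lam * q ^ n =
    coef (weighted_shift_fun (geom_weights beta) (geom_weights_bounded beta)
      (normalized_kernel lam)) (S n) * Cconj (coef (normalized_kernel lam) (S n)))%C.
  unfold weighted_shift_fun, normalized_kernel. rewrite coef_H2_of_coef.
  fold c. simpl shift_coef. unfold geom_weights.
  replace (S n - 1)%nat with n by lia.
  rewrite !coef_scal, !coef_kernel, Cmult_conj, Cpow_conj, Cconj_conj, Cconj_RtoC.
  unfold q. rewrite Cmod2_conj, !Cpow_mult_l, <- Hcc. simpl. ring.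
- change (RtoC (1 - Cmod lam ^ 2) * lam * / (1 - q) = ber_symbol beta lam -
    coef (weighted_shift_fun (geom_weights beta) (geom_weights_bounded beta)
      (normalized_kernel lam)) 0 * Cconj (coef (normalized_kernel lam) 0))%C.
  unfold weighted_shift_fun. rewrite coef_H2_of_coef. simpl shift_coef.
  unfold ber_symbol, Cdiv. fold q. ring.
Qed.

(** Once |lam| is fixed to be [r], the equation w = [ber_symbol beta lam] is linear in lam. Its
    solution [l] has modulus exactly [r] by the hypothesis on |w|, so it solves the original
    equation, also when w = 0. *)
Lemma ber_symbol_surj (beta : unit_disc) (w : C) (r : R) : 0 <= r < 1 ->
  ber_radius beta r = Cmod w -> exists lam : unit_disc, w = ber_symbol beta lam.
Proof.
intros Hr E.
assert (Hp := Cmod_1_minus_scal_pos beta r ltac:(lra)).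
assert (Hr2 : 0 < 1 - r ^ 2) by nra.
assert (Hr2C : RtoC (1 - r ^ 2) <> 0) by (intros H; apply RtoC_inj in H; lra).
set (l := (w * (1 - beta * RtoC (r ^ 2)) / RtoC (1 - r ^ 2))%C).
assert (Hl : Cmod l = r).
{ unfold l. rewrite Cmod_div by exact Hr2C.
  rewrite Cmod_mult, <- E, Cmod_R, Rabs_pos_eq by lra.
  unfold ber_radius. field. lra. }
assert (Hl1 : Cmod l < 1) by lra.
exists (mk_disc l Hl1). unfold ber_symbol; simpl disc_val. rewrite Hl.
unfold l. field. split; [exact Hr2C|apply Cmod_gt_0; exact Hp].
Qed.

Lemma convex_set_closed_disc (c : C) (r : R) : convex_set (fun w => Cmod (w - c) <= r).
Proof.
intros u v t Hu Hv Ht.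
replace (RtoC (1 - t) * u + RtoC t * v - c)%C
  with (RtoC (1 - t) * (u - c) + RtoC t * (v - c))%C
  by (rewrite RtoC_minus; ring).
eapply Rle_trans; [apply Cmod_triangle|].
rewrite !Cmod_mult, !Cmod_R, !Rabs_pos_eq by lra. nra.
Qed.

Theorem theorem3p3 (beta : unit_disc) :
  is_disc_centred 0 (Ber (weighted_shift (geom_weights beta) (geom_weights_bounded beta)))
  /\ convex_set (Ber (weighted_shift (geom_weights beta) (geom_weights_bounded beta))).
Proof.
destruct (ber_radius_range beta) as [m [Hm [Hle Hsurj]]].
assert (H : forall w,
  Ber (weighted_shift (geom_weights beta) (geom_weights_bounded beta)) w <->
  Cmod (w - 0) <= m).
{ intros w. replace (w - 0)%C with w by ring. split.
  - intros [lam ->]. rewrite inner_weighted_shift_normalized_kernel, Cmod_ber_symbol.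
    apply Hle. split; [apply Cmod_ge_0|apply disc_lt1].
  - intros Hw. destruct (Hsurj (Cmod w)) as [r [Hr E]]; [split; [apply Cmod_ge_0|exact Hw]|].
    destruct (ber_symbol_surj beta w r Hr E) as [lam ->].
    exists lam. symmetry. apply inner_weighted_shift_normalized_kernel. }
split.
(* The maximal modulus is attained, so the disc is the closed one. *)
- exists m. split; [exact Hm|]. now right.
- intros u v t Hu Hv Ht. apply H. apply H in Hu, Hv.
  now apply convex_set_closed_disc.
Qed.
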